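(* There exists a configuration of robots $\mathcal{C}_1=\{x_0',x_1',x_2',\dots,x_k'\}\subseteq X$ such that at any size-stable time $t>0$, $\mathcal{C}_1(t)$ is a mutual chain anchored at $x_0$ and $x_n$, where $x_0'=x_0$ and $x_k'=x_n$. This mutual chain is called the primary chain of $X$ and it is unique.
   Context: Model. $X=\{x_0,x_1,\dots,x_n\}$ is a finite set of robots on the real line; $x(t)$ is the position of robot $x$ at the discrete time $t=0,1,2,\dots$, and $X(t)=\{x_0(t),\dots,x_n(t)\}$ (the same symbol may denote a robot and its position). Initial positions are arbitrary, and robots need not occupy distinct positions. Exactly two robots are faulty and never move: $x_0$ is the leftmost faulty robot and $x_n$ the rightmost faulty robot, with $x_0(t)=0$ and $x_n(t)$ equal to a fixed positive number for all $t\ge0$. $V>0$ is the visibility radius. $N(x(t))$ is the set of robots $y$ with $|x(t)-y(t)|\le V$ (so $x$ itself belongs to it); $l(x(t))$ and $r(x(t))$ denote the leftmost and the rightmost robot in $N(x(t))$. All robots act synchronously: every non-faulty robot $x$ satisfies $x(t+1)=\frac{l(x(t))+r(x(t))}{2}$ for all $t\ge 0$. Non-faulty robots that end up in the same position merge: they behave identically and are considered as a single robot from then on. Size-stable time. A time $t_0$ is size-stable if, for all $t\ge t_0$: (i) there will be no inclusions (a robot entering the visibility range of a robot that did not see it before), mergings (robots coming to occupy the same position) or crossings (two robots exchanging their order on the line) in the system; and (ii) either all robots are inside the line segment $[x_0,x_n]$, or at most one robot is on each side of $[x_0,x_n]$ and stays outside of $[x_0,x_n]$; moreover, the two outsiders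 (those that exist) converge to $x_0$ and $x_n$, respectively. It is assumed that the earliest size-stable time is $0$, so that every $t\ge 0$ is size-stable. Chains. Let $m$ be an integer with $0\le m\le n$. A mutual chain at a size-stable time $t$ is a configuration $\{z_1(t),\dots,z_m(t)\}\subset X(t)$ of $m$ robots such that $l(z_{i+1}(t))=z_i(t)$ and $r(z_i(t))=z_{i+1}(t)$ for all $1\le i\le m-1$. Its left and right anchors are $l(z_1(t))$ and $r(z_m(t))$, and it is said to be anchored at these; anchors may belong to the chain, and a chain may consist of a single robot.
   Formalization: It is assumed that x_0 and x_n are joined at time 0 by a path of robots each within V of the next; on a side with an outsider the chain only starts (ends) at x_0 (x_n), without l(x_0)=x_0 (r(x_n)=x_n); the bound m ≤ n on the chain size is dropped. *)

(* Defs.v *)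
(* MathComp / MathComp-Analysis. *)
From mathcomp Require Import all_boot all_order all_algebra.
From mathcomp Require Import all_classical all_reals all_analysis.
Set Implicit Arguments.
Unset Strict Implicit.
Unset Printing Implicit Defensive.
Import Order.TTheory GRing.Theory Num.Theory.
Import numFieldNormedType.Exports.
Local Open Scope classical_set_scope.
Local Open Scope ring_scope.

(* The robots x_0, ..., x_n are the elements of 'I_n.+1, and [pos t x] is the
   position x(t).  The indices of the non-faulty robots carry no information
   on their order on the line; [ord0] and [ord_max] are the faulty robots x_0
   and x_n.  Merged robots are kept as distinct indices and identified by
   [same_robot]. *)

Section Robots.
Variables (R : realType) (n : nat) (V : R) (pos : nat -> 'I_n.+1 -> R).
Implicit Types (t s : nat) (x y : 'I_n.+1) (C : seq 'I_n.+1).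

Definition faulty x : bool := (x == ord0) || (x == ord_max).

Definition visible t : rel 'I_n.+1 :=
  fun x y => `|pos t x - pos t y| <= V.

Definition N t x : {set 'I_n.+1} := [set y | visible t x y]%SET.

(* When several robots of N t x share the extreme position, [l] and [r] pick
   one of them; only the position of [l t x] and [r t x] is used below. *)
Definition l t x : 'I_n.+1 := [arg min_(y < x in N t x) pos t y]%O.
Definition r t x : 'I_n.+1 := [arg max_(y > x in N t x) pos t y]%O.

Definition execution : Prop :=
  [/\ forall t, pos t ord0 = 0,
      0 < pos 0%N ord_max,
      forall t, pos t ord_max = pos 0%N ord_max
    & forall t x, ~~ faulty x ->
        pos t.+1 x = (pos t (l t x) + pos t (r t x)) / 2 ].

(* Faulty robots do not take part in merging. *)
Definition same_robot t : rel 'I_n.+1 := fun x y =>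
  (x == y) || [&& ~~ faulty x, ~~ faulty y & pos t x == pos t y].

(* The following three events take place between the times t and t + 1. *)
Definition inclusion t : Prop :=
  exists x y, ~~ visible t x y /\ visible t.+1 x y.

Definition merging t : Prop :=
  exists x y, pos t x != pos t y /\ pos t.+1 x = pos t.+1 y.

Definition crossing t : Prop :=
  exists x y, pos t x < pos t y /\ pos t.+1 y < pos t.+1 x.

Definition left_outsider t x : Prop := pos t x < pos t ord0.
Definition right_outsider t x : Prop := pos t ord_max < pos t x.
Definition inside t x : Prop := pos t ord0 <= pos t x <= pos t ord_max.

Definition outsiders_stable t : Prop :=
  [/\ forall x y, left_outsider t x -> left_outsider t y -> same_robot t x y,
      forall x y, right_outsider t x -> right_outsider t y -> same_robot t x y,
      forall x s, ~ inside t x -> (t <= s)%N -> ~ inside s x,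
      forall x, left_outsider t x -> pos s x @[s --> \oo] --> pos 0%N ord0
    & forall x, right_outsider t x ->
        pos s x @[s --> \oo] --> pos 0%N ord_max ].

Definition size_stable t0 : Prop :=
  forall t, (t0 <= t)%N ->
    [/\ ~ inclusion t, ~ merging t & ~ crossing t] /\
    ((forall x, inside t x) \/ outsiders_stable t).

(* [linked t z z'] : l(z'(t)) = z(t) and r(z(t)) = z'(t). *)
Definition linked t : rel 'I_n.+1 := fun z z' =>
  (pos t (l t z') == pos t z) && (pos t (r t z) == pos t z').

(* A chain is listed from left to right, its members being distinct even
   after merging. *)
Definition mutual_chain t C : Prop :=
  uniq [seq pos t z | z <- C] /\ sorted (linked t) C.

(* For a nonempty C; the default value of [head] and [last] is immaterial. *)
Definition left_anchored t C x : Prop :=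
  pos t (l t (head ord0 C)) = pos t x.
Definition right_anchored t C x : Prop :=
  pos t (r t (last ord0 C)) = pos t x.

(* An outsider next to x_0 is visible from x_0 and is then the leftmost robot
   of N(x_0): the chain starts at the anchor x_0 although l(x_0) <> x_0.  The
   same holds at x_n. *)
Definition primary_chain C : Prop :=
  [/\ ohead C = Some ord0,
      last ord0 C = ord_max
    & forall t, (0 < t)%N -> size_stable t ->
        [/\ mutual_chain t C,
            left_anchored t C ord0 \/ exists y, left_outsider t y
          & right_anchored t C ord_max \/ exists y, right_outsider t y ] ].

End Robots.

(* Main.v *)
Require Import Defs.
From mathcomp Require Import all_boot all_order all_algebra.
From mathcomp Require Import all_classical all_reals all_analysis.
From mathcomp Require Import zify lra.
Set Implicit Arguments.
Unset Strict Implicit.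
Unset Printing Implicit Defensive.
Import Order.TTheory GRing.Theory Num.Theory.
Import numFieldNormedType.Exports.
Local Open Scope ring_scope.

(* Robots that see each other keep doing so, hence without inclusions the
   visibility graph is constant.  A robot on the near side of x_n cannot
   converge to x_n: the leftmost such robot would only see robots converging to
   x_n, which would cut x_0 off from x_n.  As outsiders converge to the ends,
   the robots inside never see them, and from time 1 on no robot shares the
   position of x_0 or x_n; the order, l and r are then constant too.

   The greedy chains a_i = r^i(x_0) and c_i = l^(k-i)(x_n) have the same length
   k, because l and r are adjoint for the order, and c_i <= a_i.  As
   a_i(t+1) <= (a_{i-1}(t) + a_{i+1}(t))/2 with fixed ends, the limsup of a_i is
   at most the i-th point of the equidistant chain, and symmetrically for c_i.
   If the equidistant step is less than V, then c_i and a_{i+1} end up seeing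
   each other, so that a_i and c_i have the same extreme neighbours and would
   merge: a_i = c_i, i.e. the greedy chain is mutual.  If the step is V, both
   chains are rigid. *)

(** * Discrete maximum principle *)

(* Comparison with the strictly concave barrier [w i = i (k - i) + 1], whose
   average over the neighbours of [i] is [w i - 1]. *)
Lemma subharmonic_decay (R : realType) (k : nat) (u : nat -> nat -> R) (eps : R) :
  (forall t, u t 0%N <= 0) -> (forall t, u t k <= 0) ->
  (forall t i, (i.+1 < k)%N -> u t.+1 i.+1 <= (u t i + u t i.+2) / 2) ->
  0 < eps -> exists s, forall t i, (s <= t)%N -> (i <= k)%N -> u t i <= eps.
Proof.
move=> u0 uk usub eps0.
pose w i : R := i%:R * (k%:R - i%:R) + 1; pose W : R := k%:R ^+ 2 + 1.
(* [M] dominates every [u 0 i], and [w >= 1]. Averaging lowers [w] by 1, and [w <= W] turns this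
   into a factor: [w i - 1 <= rho * w i]. *)
pose M := \sum_(i < k.+1) `|u 0%N i|; pose rho : R := 1 - W^-1.
have M0 : 0 <= M by apply: sumr_ge0.
have W1 : 1 <= W by rewrite lerDr sqr_ge0.
have Wi0 : 0 < W^-1 by rewrite invr_gt0; lra.
have Wi1 : W^-1 <= 1 by rewrite invf_le1 //; lra.
have w1 i : (i <= k)%N -> 1 <= w i.
  by move=> ik; rewrite lerDr mulr_ge0 // subr_ge0 ler_nat.
have wW i : (i <= k)%N -> w i <= W.
  move=> ik; rewrite lerD2r expr2 ler_pM // ?subr_ge0 ?ler_nat //.
  by rewrite gerBl.
have rho0 : 0 <= rho by rewrite subr_ge0.
have bound t i : (i <= k)%N -> u t i <= M * rho ^+ t * w i.
  elim: t i => [|t IH] i ik.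
    rewrite expr0 mulr1; apply: (@le_trans _ _ M); last by rewrite ler_peMr // w1.
    apply: le_trans (ler_norm _) _; rewrite /M.
    rewrite (bigD1 (Ordinal (ik : i < k.+1)%N)) //= lerDl.
    by apply: sumr_ge0.
  have Mt0 s : 0 <= M * rho ^+ s by rewrite mulr_ge0 // exprn_ge0.
  have Mw0 : 0 <= M * rho ^+ t.+1 * w i.
    by rewrite mulr_ge0 //; apply: le_trans (w1 _ ik).
  case: i ik Mw0 => [|i] ik Mw0; first exact: le_trans (u0 _) Mw0.
  have [ek|ink] := eqVneq i.+1 k.
    by apply: le_trans Mw0; rewrite ek; exact: uk.
  have ik1 : (i.+1 < k)%N by rewrite ltn_neqAle ink ik.
  have h1 := IH i (ltnW ik); have h2 := IH i.+2 ik1.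
  apply: le_trans (usub t i ik1) _.
  have -> : M * rho ^+ t.+1 * w i.+1 = M * rho ^+ t * (rho * w i.+1).
    by rewrite exprSr !mulrA.
  have : w i.+1 - 1 <= rho * w i.+1.
    rewrite /rho mulrBl mul1r lerD2l lerN2.
    by rewrite ler_pdivrMl ?mulr1 ?wW //; lra.
  have e : w i + w i.+2 = 2 * (w i.+1 - 1).
    by rewrite /w -!natr1; lra.
  move=> /(ler_wpM2l (Mt0 t)); apply: le_trans.
  by rewrite mulrBr mulr1; nra.
have rho_lt1 : `|rho| < 1 by rewrite ger0_norm // /rho; lra.
(* The [+ 1] keeps the denominator positive when [M = 0]. *)
have /cvgrPdist_lt /(_ (eps / (M * W + 1))) := cvg_expr rho_lt1.
have MW : 0 <= M * W by rewrite mulr_ge0 //; lra.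
case; first by rewrite divr_gt0 //; lra.
move=> s _ hs; exists s => t i st ik.
have {hs} /= := hs t st.
rewrite sub0r normrN ger0_norm ?exprn_ge0 // ltr_pdivlMr; last by lra.
have r0 : 0 <= rho ^+ t by rewrite exprn_ge0.
move=> h; apply: le_trans (bound t i ik) _.
have : M * rho ^+ t * w i <= M * rho ^+ t * W.
  by rewrite ler_wpM2l ?wW // mulr_ge0.
nra.
Qed.

(** * Reflection-symmetric form of the dynamics *)

Section Dynamics.
Context {R : realType} {T : finType} (V : R).
Implicit Types (pos : nat -> T -> R) (A B x y z p q : T) (t s : nat).

Definition sees pos t : rel T := fun x y => `|pos t x - pos t y| <= V.

Definition tends_to pos x (c : R) : Prop :=
  forall eps, 0 < eps -> exists s, forall t, (s <= t)%N -> `|pos t x - c| <= eps.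

(** A relation rather than a choice of robots: ties are harmless, and negating positions just swaps
    [p] and [q]. *)
Definition extremes pos t x p q : Prop :=
  [/\ sees pos t x p, sees pos t x q &
      forall y, sees pos t x y -> pos t p <= pos t y <= pos t q].

(* Invariant under [pos |-> - pos] with [A] and [B] exchanged, so that each
   statement about the side of [B] also gives the one about the side of [A]. *)
Record dynamics pos A B : Prop := Dynamics {
  dyn_V : 0 < V;
  dyn_fixA : forall t, pos t A = pos 0%N A;
  dyn_fixB : forall t, pos t B = pos 0%N B;
  dyn_AB : pos 0%N A < pos 0%N B;
  dyn_step : forall t x, x != A -> x != B -> exists p q,
    extremes pos t x p q /\ pos t.+1 x = (pos t p + pos t q) / 2;
  dyn_lt : forall t x y, pos t x < pos t y -> pos t.+1 x < pos t.+1 y;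
  dyn_sees : forall t x y, sees pos t.+1 x y -> sees pos t x y;
  dyn_outA : forall t x, pos t x < pos 0%N A -> tends_to pos x (pos 0%N A);
  dyn_outB : forall t x, pos 0%N B < pos t x -> tends_to pos x (pos 0%N B);
  dyn_connect : connect (sees pos 0) A B }.

Lemma seesC pos t : symmetric (sees pos t).
Proof. by move=> x y; rewrite /sees distrC. Qed.

Lemma seesP pos t x y :
  reflect (pos t x - V <= pos t y <= pos t x + V) (sees pos t x y).
Proof.
rewrite /sees ler_norml; apply: (iffP idP) => /andP[h1 h2]; apply/andP; split; lra.
Qed.

Lemma sees_opp pos t x y : sees (fun s z => - pos s z) t x y = sees pos t x y.
Proof. by rewrite /sees -opprD normrN. Qed.

Lemma tends_to_opp pos x c :
  tends_to pos x c -> tends_to (fun s z => - pos s z) x (- c).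
Proof.
move=> h eps /h[s hs]; exists s => t /hs.
by rewrite -opprD normrN.
Qed.

Lemma extremes_opp pos t x p q :
  extremes pos t x p q -> extremes (fun s z => - pos s z) t x q p.
Proof.
case=> hp hq hpq; split; rewrite ?sees_opp // => y; rewrite sees_opp => /hpq.
by rewrite !lerN2 andbC.
Qed.

Lemma dynamics_opp pos A B :
  dynamics pos A B -> dynamics (fun s z => - pos s z) B A.
Proof.
case=> hV hA hB hAB hst hlt hs oA oB hc; split => //.
- by move=> t; rewrite hB.
- by move=> t; rewrite hA.
- by rewrite ltrN2.
- move=> t x xB xA; have [p [q [/extremes_opp pq e]]] := hst t x xA xB.
  exists q, p; split=> //; rewrite e; lra.
- by move=> t x y; rewrite !ltrN2; apply: hlt.
- by move=> t x y; rewrite !sees_opp; apply: hs.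
- by move=> t x; rewrite ltrN2 => /oB/tends_to_opp.
- by move=> t x; rewrite ltrN2 => /oA/tends_to_opp.
- rewrite (@eq_connect _ _ (sees pos 0)); last by move=> x y; rewrite sees_opp.
  by rewrite (sym_connect_sym (@seesC pos 0)).
Qed.

Lemma connect_cut (e : rel T) (P : pred T) x y :
  connect e x y -> P x -> ~~ P y -> exists p q, [/\ e p q, P p & ~~ P q].
Proof.
move=> /connectP[s]; elim: s x => [|z s IH] x /=.
  by move=> _ -> ->.
case/andP=> exz pz yE Px Py; case: (boolP (P z)) => Pz; last by exists x, z.
exact: (IH z).
Qed.

(** * Constant visibility, and robots at or beyond [B] *)

Section OneSide.
Variables (pos : nat -> T -> R) (A B : T).
Hypothesis dyn : dynamics pos A B.

Lemma fixed_lt t : pos t A < pos t B.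
Proof. by rewrite (dyn_fixA dyn) (dyn_fixB dyn) (dyn_AB dyn). Qed.

Lemma sees_refl t x : sees pos t x x.
Proof. by rewrite /sees subrr normr0 ltW // (dyn_V dyn). Qed.

Lemma fixed_or_moves t x :
  (forall s, pos s x = pos 0%N x) \/ (exists p q,
    extremes pos t x p q /\ pos t.+1 x = (pos t p + pos t q) / 2).
Proof.
have [-> | xA] := eqVneq x A; first by left; exact: dyn_fixA dyn.
have [-> | xB] := eqVneq x B; first by left; exact: dyn_fixB dyn.
by right; apply: (dyn_step dyn).
Qed.

(** If both move, the extremes seen by [y] are at most [x] and [y + V], since [y] sees [x], while
    those seen by [x] are at least [x - V] and [y]. The midpoints thus differ by at most [V], and
    the other direction is symmetric. *)
Lemma sees_keep t x y : sees pos t x y -> sees pos t.+1 x y.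
Proof.
move=> xy; have yx : sees pos t y x by rewrite seesC.
have xx := sees_refl t x; have yy := sees_refl t y; have V0 := dyn_V dyn.
apply/seesP; case: (fixed_or_moves t x) => [fx|[p [q [[xp xq hx] ->]]]];
  case: (fixed_or_moves t y) => [fy|[p' [q' [[yp yq hy] ->]]]].
- by move/seesP: xy; rewrite !fx !fy.
- move: (hy _ yx) (hy _ yy) => /andP[h1 h2] /andP[h3 h4].
  move/seesP: yp => /andP[h5 h6]; move/seesP: yq => /andP[h7 h8].
  move/seesP: xy => /andP[h9 h10].
  rewrite fx -(fx t); apply/andP; split; lra.
- move: (hx _ xy) (hx _ xx) => /andP[h1 h2] /andP[h3 h4].
  move/seesP: xp => /andP[h5 h6]; move/seesP: xq => /andP[h7 h8].
  move/seesP: xy => /andP[h9 h10].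
  rewrite fy -(fy t); apply/andP; split; lra.
- move: (hy _ yx) (hy _ yy) => /andP[h1 h2] /andP[h3 h4].
  move: (hx _ xy) (hx _ xx) => /andP[g1 g2] /andP[g3 g4].
  move/seesP: xp => /andP[h5 h6]; move/seesP: xq => /andP[h7 h8].
  move/seesP: yp => /andP[g5 g6]; move/seesP: yq => /andP[g7 g8].
  apply/andP; split; lra.
Qed.

Lemma sees_const t x y : sees pos t x y = sees pos 0 x y.
Proof.
elim: t => // t <-; apply/idP/idP; first exact: (dyn_sees dyn).
exact: sees_keep.
Qed.

Lemma lt_keep s t x y : (s <= t)%N -> pos s x < pos s y -> pos t x < pos t y.
Proof.
move=> /subnK <-; elim: (t - s)%N => [//|m IH] h.
by rewrite addSn; apply: (dyn_lt dyn); apply: IH.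
Qed.

(** Some visibility edge on a path from [A] to [B] passes from strictly left of [z] to [z] or
    beyond; its left end is then within [V] of [z]. *)
Lemma sees_before t z : pos t A < pos t z -> pos t z <= pos t B ->
  exists2 p, sees pos t z p & pos t p < pos t z.
Proof.
move=> Az zB.
have cn : connect (sees pos t) A B.
  by rewrite (@eq_connect _ _ (sees pos 0)) ?(dyn_connect dyn) // => x y;
    exact: sees_const.
have nB : ~~ (pos t B < pos t z) by rewrite -leNgt.
have [p [q [pq pz qz]]] := connect_cut (P := fun p => pos t p < pos t z) cn Az nB.
exists p => //; move: qz; rewrite -leNgt => qz; have V0 := dyn_V dyn.
by move/seesP: pq => /andP[h1 h2]; apply/seesP/andP; split; lra.
Qed.

(** A robot that is ever beyond [B] converges to [B], and the others never exceed it. Finiteness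
    gives a common rank. *)
Lemma eventually_below (eps : R) : 0 < eps ->
  exists s, forall t p, (s <= t)%N -> pos t p <= pos 0%N B + eps.
Proof.
move=> eps0.
have /choice[s hs] : forall p, exists s,
    forall t, (s <= t)%N -> pos t p <= pos 0%N B + eps.
  move=> p; case: (pselect (exists t, pos 0%N B < pos t p)) => [[t0 ht0]|h].
    have [s hs] := dyn_outB dyn ht0 eps0; exists s => t /hs.
    by rewrite ler_norml => /andP[_]; lra.
  exists 0%N => t _; have : ~ (pos 0%N B < pos t p) by move=> h'; apply: h; exists t.
  by move/negP; rewrite -leNgt => h'; lra.
exists (\max_p s p)%N => t p h; apply: (hs p t); apply: leq_trans h.
exact: leq_bigmax.
Qed.

(* The rightmost robot seen by [z] is eventually below [B + eps], so the
   leftmost one is forced to [B] as well. *)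
Lemma tends_near z p : tends_to pos z (pos 0%N B) -> z != A -> z != B ->
  sees pos 0 z p -> tends_to pos p (pos 0%N B).
Proof.
move=> hz zA zB zp eps eps0.
(* From [(P + Q) / 2 >= B - eps / 3] and [Q <= B + eps / 3] follows [P >= B - eps]. *)
have e0 : 0 < eps / 3 by lra.
have [s1 h1] := hz _ e0; have [s2 h2] := eventually_below e0.
exists (maxn s1 s2) => t; rewrite geq_max => /andP[t1 t2].
have [P [Q [[zP zQ /(_ p)]]]] := dyn_step dyn t zA zB.
rewrite sees_const => /(_ zp)/andP[Pp pQ] e.
have := h1 t.+1 (leqW t1); rewrite e => /ler_normlP[h3 h4].
have := h2 t Q t2; have := h2 t p t2.
by move=> h5 h6; apply/ler_normlP; split; lra.
Qed.

Lemma tends_notA z : tends_to pos z (pos 0%N B) -> ~ exists t, pos t z < pos t A.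
Proof.
move=> hz [t ht]; have AB := dyn_AB dyn.
have e0 : 0 < (pos 0%N B - pos 0%N A) / 2 by lra.
have [s hs] := hz _ e0.
have := hs (maxn s t) (leq_maxl _ _).
have := lt_keep (leq_maxr s t) ht.
by rewrite (dyn_fixA dyn) => h /ler_normlP[h1 h2]; lra.
Qed.

Lemma not_tendsA : ~ tends_to pos A (pos 0%N B).
Proof.
move=> hz; have AB := dyn_AB dyn.
have e0 : 0 < (pos 0%N B - pos 0%N A) / 2 by lra.
have [s hs] := hz _ e0.
by have := hs s (leqnn s); rewrite (dyn_fixA dyn) => /ler_normlP[h1 h2]; lra.
Qed.

(* The leftmost robot with limit [B] would only see robots with limit [B],
   hence none on its left: this disconnects [A] from [B]. *)
Lemma tends_beyond t z :
  tends_to pos z (pos 0%N B) -> z != B -> pos t B < pos t z.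
Proof.
move=> hz zB; rewrite ltNge; apply/negP => zleB.
pose P z := `[< tends_to pos z (pos 0%N B) >] && (z != B).
have Pz : P z by rewrite /P zB andbT; apply/asboolP.
case: (@arg_minP _ _ T z P (pos t) Pz) => m /andP[/asboolP mt mB] mmin.
have mleB : pos t m <= pos t B := le_trans (mmin _ Pz) zleB.
have mA : m != A by apply/eqP => mA; apply: not_tendsA; rewrite -mA.
have Am : pos t A < pos t m.
  rewrite lt_neqAle; apply/andP; split; last first.
    by rewrite leNgt; apply/negP => h; apply: (tends_notA mt); exists t.
  (* At the position of [A], [m] would see [A], which would then tend to [B] as well. *)
  apply/eqP => Am; apply: not_tendsA; apply: (tends_near mt mA mB).
  by rewrite -(sees_const t) /sees Am subrr normr0 ltW // (dyn_V dyn).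
have [p mp pm] := sees_before Am mleB.
have /mmin : P p.
  rewrite /P; apply/andP; split.
    apply/asboolP; apply: (tends_near mt mA mB).
    by rewrite -(sees_const t).
  by apply/eqP => pB; move: pm; rewrite pB ltNge mleB.
by rewrite leNgt pm.
Qed.

(** If [v] were beyond [B] it would tend to [B]; so would [z], which sees it, and [tends_beyond]
    would put [z] beyond [B] too. *)
Lemma inside_unseen t z v : z != B -> pos t z <= pos t B ->
  sees pos t z v -> pos t v <= pos t B.
Proof.
move=> zB zleB zv; rewrite leNgt; apply/negP => Bv.
have vt : tends_to pos v (pos 0%N B).
  by apply: (dyn_outB dyn (t := t)); rewrite -(dyn_fixB dyn t).
have vB : v != B by apply: contraTneq Bv => ->; rewrite ltxx.
have vA : v != A by apply/eqP => vA; apply: not_tendsA; rewrite -vA.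
have zt : tends_to pos z (pos 0%N B).
  by apply: (tends_near vt vA vB); rewrite seesC -(sees_const t).
by have := tends_beyond t zt zB; rewrite ltNge zleB.
Qed.

(** A tie at [t.+1] comes from a tie at [t], strict order being preserved. But a robot tied with [B]
    sees someone strictly on its left and nobody beyond [B], so it moves left. A tie at time 0 is
    not excluded. *)
Lemma no_tie t z : z != B -> pos t.+1 z != pos t.+1 B.
Proof.
move=> zB; apply/eqP => e.
have eT : pos t z = pos t B.
  apply/eqP; rewrite eq_le !leNgt; apply/andP; split; apply/negP => /(dyn_lt dyn);
  by rewrite e ltxx.
have zA : z != A.
  by apply/eqP => zA; have := fixed_lt t; rewrite -zA eT ltxx.
have Az : pos t A < pos t z by rewrite eT fixed_lt.
have zleB : pos t z <= pos t B by rewrite eT.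
have [p zp pz] := sees_before Az zleB.
have [P [Q [[zP zQ /(_ p zp)/andP[Pp _]]]]] := dyn_step dyn t zA zB.
have := inside_unseen zB zleB zQ; rewrite e.
rewrite !(dyn_fixB dyn) in eT * => h1 h2; lra.
Qed.

End OneSide.
End Dynamics.

(** * Constant order, and the greedy chains between [A] and [B] *)

Section Chain.
Context {R : realType} {T : finType} (V : R).
Implicit Types (x y z p q : T) (t s i j : nat).
Variables (pos : nat -> T -> R) (A B : T) (l r : T -> T).
Hypothesis dyn : dynamics V pos A B.
Hypothesis tieA : forall t z, z != A -> pos t z != pos t A.
Hypothesis tieB : forall t z, z != B -> pos t z != pos t B.
Hypothesis lP : forall x, sees V pos 0 x (l x).
Hypothesis rP : forall x, sees V pos 0 x (r x).
Hypothesis l_le : forall x y, sees V pos 0 x y -> pos 0%N (l x) <= pos 0%N y.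
Hypothesis r_ge : forall x y, sees V pos 0 x y -> pos 0%N y <= pos 0%N (r x).

Lemma sees_eq t x x' y : pos t x = pos t x' -> sees V pos t x y = sees V pos t x' y.
Proof. by rewrite /sees => ->. Qed.

Lemma extremes_eq t x x' p q p' q' : pos t x = pos t x' ->
  extremes V pos t x p q -> extremes V pos t x' p' q' ->
  pos t p = pos t p' /\ pos t q = pos t q'.
Proof.
move=> e [xp xq hx] [xp' xq' hx'].
rewrite !(sees_eq _ e) in xp xq; rewrite -!(sees_eq _ e) in xp' xq'.
have /andP[a1 a2] := hx _ xp'; have /andP[a3 a4] := hx _ xq'.
have /andP[b1 b2] := hx' _ xp; have /andP[b3 b4] := hx' _ xq.
by split; apply/eqP; rewrite eq_le; apply/andP.
Qed.

(** Tied robots have the same extremes, and [tieA] and [tieB] ensure that two distinct tied robots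
    both move. With [dyn_lt] this makes the order constant. *)
Lemma eq_keep t x y : pos t x = pos t y -> pos t.+1 x = pos t.+1 y.
Proof.
have [-> //|xy] := eqVneq x y => e.
have noA u v : u != v -> pos t u = pos t v -> u != A.
  move=> uv euv; apply/eqP => uA; have /(tieA t) : v != A by rewrite -uA eq_sym.
  by rewrite -uA euv eqxx.
have noB u v : u != v -> pos t u = pos t v -> u != B.
  move=> uv euv; apply/eqP => uA; have /(tieB t) : v != B by rewrite -uA eq_sym.
  by rewrite -uA euv eqxx.
have yx : y != x by rewrite eq_sym.
have [p [q [xpq ->]]] := dyn_step dyn t (noA _ _ xy e) (noB _ _ xy e).
have [p' [q' [ypq ->]]] := dyn_step dyn t (noA _ _ yx (esym e)) (noB _ _ yx (esym e)).
by have [-> ->] := extremes_eq e xpq ypq.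
Qed.

Lemma le_const t x y : (pos t x <= pos t y) = (pos 0%N x <= pos 0%N y).
Proof.
elim: t => // t <-; case: (ltgtP (pos t x) (pos t y)) => [h|h|/eq_keep -> //].
- by rewrite ltW // (dyn_lt dyn).
- by apply/negbTE; rewrite -ltNge (dyn_lt dyn).
by rewrite lexx.
Qed.

Lemma lt_const t x y : (pos t x < pos t y) = (pos 0%N x < pos 0%N y).
Proof. by rewrite !ltNge le_const. Qed.

Lemma eq_const t x y : (pos t x == pos t y) = (pos 0%N x == pos 0%N y).
Proof. by rewrite !eq_le !le_const. Qed.

Lemma extremes_lr t x : extremes V pos t x (l x) (r x).
Proof.
split; rewrite ?(sees_const dyn) // => y; rewrite (sees_const dyn) => xy.
by rewrite !le_const l_le // r_ge.
Qed.

Lemma step_lr t x : x != A -> x != B ->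
  pos t.+1 x = (pos t (l x) + pos t (r x)) / 2.
Proof.
move=> xA xB; have [p [q [pq ->]]] := dyn_step dyn t xA xB.
by have [-> ->] := extremes_eq erefl pq (extremes_lr t x).
Qed.

Notation pos0 := (pos 0%N).

(** Absorption at [B] keeps the iterates in the segment, whereas [r B] may be an outsider. *)
Definition right_step x := if x == B then B else r x.
Definition left_step x := if x == A then A else l x.
Definition between x := pos0 A <= pos0 x <= pos0 B.

Lemma le_r x : pos0 x <= pos0 (r x).
Proof. by apply: r_ge; apply: (sees_refl dyn). Qed.

Lemma l_le_self x : pos0 (l x) <= pos0 x.
Proof. by apply: l_le; apply: (sees_refl dyn). Qed.

Lemma between_right_step x : between x -> between (right_step x).
Proof.
rewrite /between /right_step => /andP[Ax xB]; have [_|nB] := eqVneq x B.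
  by rewrite lexx andbT ltW // (dyn_AB dyn).
by rewrite (le_trans Ax (le_r x)) /= (inside_unseen dyn nB xB).
Qed.

Lemma between_left_step x : between x -> between (left_step x).
Proof.
rewrite /between /left_step => /andP[Ax xB]; have [_|nA] := eqVneq x A.
  by rewrite lexx ltW // (dyn_AB dyn).
rewrite (le_trans (l_le_self x) xB) andbT.
have := inside_unseen (dynamics_opp dyn) (t := 0%N) (z := x) (v := l x) nA.
by rewrite !lerN2 sees_opp => ->.
Qed.

Lemma between_neqB x : between x -> (x != B) = (pos0 x < pos0 B).
Proof.
move=> /andP[_ xB]; rewrite lt_neqAle xB andbT; apply/idP/idP; first exact: tieB.
by apply: contraNneq => ->.
Qed.

Lemma between_neqA x : between x -> (x != A) = (pos0 A < pos0 x).
Proof.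
move=> /andP[Ax _]; rewrite lt_neqAle Ax andbT eq_sym.
apply/idP/idP; last by apply: contraNneq => ->.
by rewrite eq_sym => /(tieA 0); rewrite eq_sym.
Qed.

Lemma lt_right_step x : between x -> x != B -> pos0 x < pos0 (right_step x).
Proof.
move=> bx nB; rewrite /right_step (negbTE nB).
have xB : pos0 x < pos0 B by rewrite -between_neqB.
have [|| p xp xltp] := sees_before (dynamics_opp dyn) (t := 0%N) (z := x).
- by rewrite ltrN2.
- by rewrite lerN2; case/andP: bx.
by rewrite sees_opp in xp; rewrite ltrN2 in xltp; apply: lt_le_trans xltp (r_ge xp).
Qed.

(** Away from the absorbing ends, both sides are trivial if [y <= x]. If [x < y], each says that [x]
    and [y] see each other: whoever sees a robot at or past the other also sees the other. *)
Lemma step_adjunction x y : between x -> between y ->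
  (pos0 (left_step y) <= pos0 x) = (pos0 y <= pos0 (right_step x)).
Proof.
move=> bx bx'; have [/andP[Ax xB] /andP[Ay yB]] := (bx, bx').
rewrite /left_step /right_step.
have [->|yA] := eqVneq y A; have [xE|nB] := eqVneq x B.
- by rewrite Ax ltW // (dyn_AB dyn).
- by rewrite Ax (le_trans Ax (le_r x)).
- by rewrite xE yB (le_trans (l_le_self y) yB).
have V0 := dyn_V dyn.
have [yx|xy] := lerP (pos0 y) (pos0 x).
  by rewrite (le_trans yx (le_r x)) (le_trans (l_le_self y) yx).
apply/idP/idP => h.
  apply: r_ge; rewrite seesC; move/seesP: (lP y) => /andP[h1 h2].
  by apply/seesP/andP; split; lra.
apply: l_le; rewrite seesC; move/seesP: (rP x) => /andP[h1 h2].
by apply/seesP/andP; split; lra.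
Qed.

Lemma between_iter_right i x : between x -> between (iter i right_step x).
Proof. by move=> bx; elim: i => //= i; exact: between_right_step. Qed.

Lemma between_iter_left i x : between x -> between (iter i left_step x).
Proof. by move=> bx; elim: i => //= i; exact: between_left_step. Qed.

Lemma iter_adjunction i x y : between x -> between y ->
  (pos0 (iter i left_step y) <= pos0 x) = (pos0 y <= pos0 (iter i right_step x)).
Proof.
move=> + by_; elim: i x => // i IH x bx; rewrite iterS iterSr.
rewrite step_adjunction ?IH //; first exact: between_right_step.
exact: between_iter_left.
Qed.

Lemma betweenA : between A.
Proof. by rewrite /between lexx ltW // (dyn_AB dyn). Qed.

Lemma betweenB : between B.
Proof. by rewrite /between lexx andbT ltW // (dyn_AB dyn). Qed.

Lemma right_step_reaches x : between x -> exists k, iter k right_step x = B.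
Proof.
(* Induction on the number of robots strictly to the right, which each step decreases. *)
have [m] := ubnP #|[set y | pos0 x < pos0 y]|; elim: m x => // m IH x hm bx.
have [->|nB] := eqVneq x B; first by exists 0%N.
have lt := lt_right_step bx nB.
case: (IH (right_step x)) => [||k hk]; last by exists k.+1; rewrite iterSr.
  rewrite -ltnS; apply: leq_trans hm; rewrite ltnS; apply: proper_card.
  apply/properP; split.
    by apply/fintype.subsetP => y; rewrite !inE; apply: lt_trans.
  by exists (right_step x); rewrite !inE ?lt ?ltxx.
exact: between_right_step.
Qed.

(** Here [k] is the least number of right steps from [A] to [B], and [c] is indexed so that it ends
    at [B]. By adjunction, [c i <= a i] because [k - i] right steps lead from [a i] to [B]. *)
Lemma greedy_chains : exists (k : nat) (a c : nat -> T),
  [/\ [/\ a 0%N = A, a k = B, c 0%N = A & c k = B],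
      forall i, (i < k)%N ->
        [/\ a i.+1 = r (a i), c i = l (c i.+1) & pos0 (a i) < pos0 (a i.+1)],
      forall i, (i <= k)%N -> pos0 (c i) <= pos0 (a i)
    & forall i, (0 < i < k)%N -> [&& a i != A, a i != B, c i != A & c i != B] ].
Proof.
have hex : exists k, iter k right_step A == B.
  by have [k hk] := right_step_reaches betweenA; exists k; apply/eqP.
pose k := ex_minn hex.
pose a i := iter i right_step A; pose c i := iter (k - i) left_step B.
have [ak amin] : a k = B /\ forall j, a j = B -> (k <= j)%N.
  by rewrite /a /k; case: ex_minnP => m /eqP mB h; split=> // j /eqP /h.
have ba i : between (a i) := between_iter_right i betweenA.
have bc i : between (c i) := between_iter_left _ betweenB.
have ca i : (i <= k)%N -> pos0 (c i) <= pos0 (a i).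
  move=> ik; rewrite iter_adjunction //; last exact: betweenB.
  by rewrite /a -iterD subnK // -/(a k) ak.
have aB i : (i < k)%N -> a i != B.
  by move=> ik; apply/eqP => /amin; rewrite leqNgt ik.
(* Otherwise the adjunction would bring [A] to [B] in [k - i] right steps, against the minimality of
   [k]. *)
have cA i : (0 < i <= k)%N -> c i != A.
  move=> /andP[i0 ik]; apply/eqP => ciA.
  have : pos0 (c i) <= pos0 A by rewrite ciA.
  rewrite iter_adjunction; [|exact: betweenA|exact: betweenB].
  rewrite -/(a (k - i)%N) leNgt -between_neqB // negbK => /eqP /amin.
  by rewrite leqNgt ltn_subrL i0 (leq_trans i0 ik).
exists k, a, c; split.
- split=> //; last by rewrite /c subnn.
  (* [c 0 <= a 0 = A], and only [A] itself occupies that position. *)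
  apply/eqP; rewrite -[_ == _]negbK between_neqA // -leNgt.
  by rewrite (le_trans (ca 0%N _)).
- move=> i ik; split.
  + by rewrite /a iterS /right_step (negbTE (aB _ ik)).
  + by rewrite {1}/c -(subnSK ik) iterS -/(c i.+1) /left_step (negbTE (cA _ _)).
  + by rewrite /a iterS; apply: lt_right_step; [exact: ba|exact: aB].
- exact: ca.
move=> i /andP[i0 ik]; have cle := ca i (ltnW ik).
have ciA : c i != A by rewrite cA // i0 ltnW.
rewrite ciA aB //= between_neqA // between_neqB //.
rewrite between_neqA // in ciA; rewrite (lt_le_trans ciA cle) /=.
by apply: le_lt_trans cle _; rewrite -between_neqB // aB.
Qed.

(** The deviation [u] from the equidistant chain vanishes at both ends. It is subharmonic inside:
    the right extreme of [a i.+1] is [a i.+2], and the left one is at most [a i], which [a i.+1]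
    sees. *)
Lemma chain_limit (k : nat) (a : nat -> T) (eps : R) :
  (0 < k)%N -> a 0%N = A -> a k = B ->
  (forall i, (i < k)%N -> a i.+1 = r (a i)) ->
  (forall i, (0 < i < k)%N -> (a i != A) && (a i != B)) -> 0 < eps ->
  exists s, forall t i, (s <= t)%N -> (i <= k)%N ->
    pos t (a i) <= pos0 A + i%:R * ((pos0 B - pos0 A) / k%:R) + eps.
Proof.
move=> k0 a0 ak aS aAB eps0; set d := _ / _.
pose u t i := pos t (a i) - pos0 A - i%:R * d.
case: (@subharmonic_decay R k u eps) => //.
- by move=> t; rewrite /u a0 mul0r subr0 (dyn_fixA dyn) subrr.
- move=> t; rewrite /u ak (dyn_fixB dyn) /d mulrC divfK ?subrr //.
  by rewrite pnatr_eq0 -lt0n.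
- move=> t i ik; have /andP[nA nB] := aAB i.+1 ik.
  rewrite /u step_lr // -(aS i.+1 ik) -[i.+2%:R]natr1 -[i.+1%:R]natr1.
  have /andP[h _] : pos t (l (a i.+1)) <= pos t (a i) <= pos t (r (a i.+1)).
    have [_ _] := extremes_lr t (a i.+1); apply.
    by rewrite seesC (sees_const dyn) aS ?rP // ltnW.
  by lra.
by move=> s hs; exists s => t i st ik; have := hs t i st ik; rewrite /u; lra.
Qed.

End Chain.

(** * Agreement of the two greedy chains *)

Section Agreement.
Context {R : realType} {T : finType} (V : R).
Implicit Types (x y z p q : T) (t s i j : nat).
Variables (pos : nat -> T -> R) (A B : T) (l r : T -> T).
Hypothesis dyn : dynamics V pos A B.
Hypothesis tieA : forall t z, z != A -> pos t z != pos t A.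
Hypothesis tieB : forall t z, z != B -> pos t z != pos t B.
Hypothesis lP : forall x, sees V pos 0 x (l x).
Hypothesis rP : forall x, sees V pos 0 x (r x).
Hypothesis l_le : forall x y, sees V pos 0 x y -> pos 0%N (l x) <= pos 0%N y.
Hypothesis r_ge : forall x y, sees V pos 0 x y -> pos 0%N y <= pos 0%N (r x).

Notation pos0 := (pos 0%N).

(** Reflection of [chain_limit]: positions are negated, [A] and [B] exchanged, and the chain is read
    backwards. *)
Lemma chain_limit_left (k : nat) (c : nat -> T) (eps : R) :
  (0 < k)%N -> c 0%N = A -> c k = B ->
  (forall i, (i < k)%N -> c i = l (c i.+1)) ->
  (forall i, (0 < i < k)%N -> (c i != A) && (c i != B)) -> 0 < eps ->
  exists s, forall t i, (s <= t)%N -> (i <= k)%N ->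
    pos0 A + i%:R * ((pos0 B - pos0 A) / k%:R) - eps <= pos t (c i).
Proof.
move=> k0 c0 ck cS cAB eps0.
have tB t z : z != B -> - pos t z != - pos t B by move=> /(tieB t); rewrite eqr_opp.
have tA t z : z != A -> - pos t z != - pos t A by move=> /(tieA t); rewrite eqr_opp.
have oP x y : sees V (fun s z => - pos s z) 0 x y = sees V pos 0 x y.
  exact: sees_opp.
have rP' x : sees V (fun s z => - pos s z) 0 x (r x) by rewrite oP.
have lP' x : sees V (fun s z => - pos s z) 0 x (l x) by rewrite oP.
have r_le x y : sees V (fun s z => - pos s z) 0 x y -> - pos0 (r x) <= - pos0 y.
  by rewrite oP lerN2; apply: r_ge.
have l_ge x y : sees V (fun s z => - pos s z) 0 x y -> - pos0 y <= - pos0 (l x).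
  by rewrite oP lerN2; apply: l_le.
have [] := chain_limit (dynamics_opp dyn) tB tA rP' lP' r_le l_ge
  (a := fun i => c (k - i)%N) k0 _ _ _ _ eps0.
- by rewrite subn0.
- by rewrite subnn.
- by move=> i ik; rewrite -(subnSK ik); apply: cS; rewrite ltn_subrL k0.
- by move=> i /andP[i0 ik]; rewrite andbC cAB // subn_gt0 ik ltn_subrL i0.
move=> s hs.
exists s => t i st ik; have := hs t (k - i)%N st (leq_subr _ _).
rewrite subKn // natrB //; set a := pos0 A; set b := pos0 B.
have k1 : k%:R != 0 :> R by rewrite pnatr_eq0 -lt0n.
have -> : - a - - b = b - a by lra.
have : k%:R * ((b - a) / k%:R) = b - a by rewrite mulrC divfK.
by rewrite mulrBl; lra.
Qed.

(* When [pos0 B - pos0 A < k * V], both chains get close to the equidistant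
   chain, whose step is less than [V]: then [c i] sees [a i.+1], and [a i] and
   [c i] have the same neighbours.  Otherwise every step of both chains has
   length [V]. *)
Lemma chains_agree (k : nat) (a c : nat -> T) :
  a 0%N = A -> a k = B -> c 0%N = A -> c k = B ->
  (forall i, (i < k)%N -> a i.+1 = r (a i)) ->
  (forall i, (i < k)%N -> c i = l (c i.+1)) ->
  (forall i, (i < k)%N -> pos0 (a i) <= pos0 (a i.+1)) ->
  (forall i, (i <= k)%N -> pos0 (c i) <= pos0 (a i)) ->
  (forall i, (0 < i < k)%N -> [&& a i != A, a i != B, c i != A & c i != B]) ->
  forall i, (i <= k)%N -> pos0 (c i) = pos0 (a i).
Proof.
move=> a0 ak c0 ck aS cS ale ca inner i ik.
have AB := dyn_AB dyn; have V0 := dyn_V dyn.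
have k0 : (0 < k)%N.
  by rewrite lt0n; apply/eqP => k0; move: AB; rewrite -a0 -ak k0 ltxx.
have k0R : 0 < k%:R :> R by rewrite ltr0n.
apply/eqP; rewrite eq_le ca //=.
(* In the far case, steps of length at most [V] give [a i <= A + i V <= B - (k - i) V <= c i]. *)
have [far|near] := lerP (k%:R * V) (pos0 B - pos0 A).
  have ha j : (j <= k)%N -> pos0 (a j) <= pos0 A + j%:R * V.
    elim: j => [|j IH] jk; first by rewrite a0 mul0r addr0.
    have := IH (ltnW jk); have := rP (a j); rewrite -aS // => /seesP/andP[_].
    by rewrite -natr1; lra.
  have hc j : (j <= k)%N -> pos0 B - j%:R * V <= pos0 (c (k - j)%N).
    elim: j => [|j IH] jk; first by rewrite subn0 ck mul0r subr0.
    have := IH (ltnW jk); rewrite -(subnSK jk).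
    have kj : (k - j.+1 < k)%N by rewrite ltn_subrL k0.
    have := lP (c (k - j.+1).+1); rewrite -(cS _ kj) => /seesP/andP[+ _].
    by rewrite -natr1; lra.
  have := ha i ik; have := hc (k - i)%N (leq_subr _ _).
  by rewrite subKn // natrB // mulrBl; lra.
have aAB j : (0 < j < k)%N -> (a j != A) && (a j != B).
  by move=> /inner /and4P[-> ->].
have cAB j : (0 < j < k)%N -> (c j != A) && (c j != B).
  by move=> /inner /and4P[_ _ -> ->].
pose d := (pos0 B - pos0 A) / k%:R.
have dV : d < V by rewrite ltr_pdivrMr // mulrC.
(* Two errors of this size plus one step [d] add up to exactly [V]. *)
have eps0 : 0 < (V - d) / 2 by lra.
have [s1 h1] := chain_limit dyn tieA tieB lP rP l_le r_ge k0 a0 ak aS aAB eps0.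
have [s2 h2] := chain_limit_left k0 c0 ck cS cAB eps0.
pose t := maxn s1 s2.
have leC := le_const dyn tieA tieB.
have ca_sees j : (j < k)%N -> sees V pos 0 (c j) (a j.+1).
  move=> jk; rewrite -(sees_const dyn t); apply/seesP.
  have := h1 t j.+1 (leq_maxl _ _) jk; have := h2 t j (leq_maxr _ _) (ltnW jk).
  rewrite -/d -[j.+1%:R]natr1 [(_ + 1) * d]mulrDl mul1r => g1 g2.
  have : pos t (c j) <= pos t (a j.+1).
    by rewrite leC (le_trans (ca _ (ltnW jk))) // ale.
  by move=> g3; apply/andP; split; lra.
have [->|i0] := posnP i; first by rewrite a0 c0.
have [->|ink] := eqVneq i k; first by rewrite ak ck.
have ltik : (i < k)%N by rewrite ltn_neqAle ink.
have inn : (0 < i < k)%N by rewrite i0.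
have /and4P[aA aB cA cB] := inner i inn.
have step := step_lr dyn tieA tieB lP rP l_le r_ge.
(* The order is the same at time 1, where both positions are midpoints. With [i] shifted by one,
   [l (a i.+1) <= c i = l (c i.+1)] and [r (a i.+1) = a i.+2 <= r (c i.+1)]. *)
rewrite -(leC 1%N) !step //.
case: i i0 ik ink ltik inn aA aB cA cB => // i _ ik ink ltik inn aA aB cA cB.
have := l_le (_ : sees V pos 0 (a i.+1) (c i)); rewrite seesC ca_sees // => /(_ isT).
have := r_ge (ca_sees _ ltik).
rewrite (cS i) // (aS i.+1) //; lra.
Qed.

(** Since [a i.+1] and [c i.+1] share a position, so do their leftmost visible robots, and
    [l (c i.+1) = c i] lies at [a i]. *)
Lemma greedy_chain : exists (k : nat) (a : nat -> T),
  [/\ a 0%N = A, a k = B &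
      forall i, (i < k)%N ->
        [/\ pos0 (a i) < pos0 (a i.+1), a i.+1 = r (a i)
          & pos0 (l (a i.+1)) = pos0 (a i)]].
Proof.
have [k [a [c [[a0 ak c0 ck] hS ca inner]]]] :=
  greedy_chains dyn tieA tieB lP rP l_le r_ge.
have agree := @chains_agree k a c a0 ak c0 ck.
exists k, a; split=> // i ik; have [aS cS lt] := hS i ik; split=> //.
have e j : (j <= k)%N -> pos0 (c j) = pos0 (a j).
  by apply: agree => // j' jk; have [? ? ?] := hS j' jk => //; exact: ltW.
rewrite -(e i (ltnW ik)) cS.
have [-> _] := extremes_eq (esym (e _ ik)) (extremes_lr dyn tieA tieB lP rP l_le r_ge 0 _)
  (extremes_lr dyn tieA tieB lP rP l_le r_ge 0 _).
by [].
Qed.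

End Agreement.

(** Ties with the fixed robots are excluded only from time 1 on, so the chain is built for the
    system restarted there. *)
Lemma dynamics_shift (R : realType) (T : finType) (V : R)
    (pos : nat -> T -> R) (A B : T) :
  dynamics V pos A B -> dynamics V (fun t => pos t.+1) A B.
Proof.
move=> dyn; have cn := sees_const dyn.
have [V0 fA fB AB st lt sk oA oB hc] := dyn; split => //.
- by move=> t; rewrite fA (fA 1%N).
- by move=> t; rewrite fB (fB 1%N).
- exact: fixed_lt dyn 1%N.
- by move=> t x xA xB; have [p [q [pq e]]] := st t.+1 x xA xB; exists p, q.
- by move=> t; apply: lt.
- by move=> t; apply: sk.
- move=> t x; rewrite fA => /oA h eps /h [s hs]; exists s => u su.
  by apply: hs; apply: leqW.
- move=> t x; rewrite fB => /oB h eps /h [s hs]; exists s => u su.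
  by apply: hs; apply: leqW.
- rewrite (@eq_connect _ _ (sees V pos 0)) // => x y; exact: cn 1%N x y.
Qed.

(** * Existence and uniqueness of the primary chain *)

Section Robots.
Variables (R : realType) (n : nat) (V : R) (pos : nat -> 'I_n.+1 -> R).
Implicit Types (t s : nat) (x y : 'I_n.+1) (C : seq 'I_n.+1).
Hypothesis V_gt0 : 0 < V.

Lemma visible_refl t x : visible V pos t x x.
Proof. by rewrite /visible subrr normr0 ltW. Qed.

Lemma l_spec t x : visible V pos t x (l V pos t x) /\
  forall y, visible V pos t x y -> pos t (l V pos t x) <= pos t y.
Proof.
rewrite /l; case: arg_minP; first by rewrite inE visible_refl.
by move=> y; rewrite inE => xy h; split=> // z xz; apply: h; rewrite inE.
Qed.

Lemma r_spec t x : visible V pos t x (r V pos t x) /\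
  forall y, visible V pos t x y -> pos t y <= pos t (r V pos t x).
Proof.
rewrite /r; case: arg_maxP; first by rewrite inE visible_refl.
by move=> y; rewrite inE => xy h; split=> // z xz; apply: h; rewrite inE.
Qed.

Lemma lr_extremes t x : extremes V pos t x (l V pos t x) (r V pos t x).
Proof.
have [xl hl] := l_spec t x; have [xr hr] := r_spec t x.
by split=> // y xy; rewrite hl ?hr.
Qed.

Lemma pos_r_eq t x y : pos t x = pos t y ->
  pos t (r V pos t x) = pos t (r V pos t y).
Proof. by move=> /extremes_eq /(_ (lr_extremes t x) (lr_extremes t y)) []. Qed.

Lemma cvg_tends_to x (c : R) :
  (pos s x @[s --> \oo] --> c)%classic -> tends_to pos x c.
Proof.
move=> /cvgrPdist_le h eps /h[s _ hs]; exists s => t st.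
by rewrite distrC; apply: (hs t).
Qed.

(** Absence of mergings and crossings gives [dyn_lt], absence of inclusions gives [dyn_sees]. The
    limits come from [outsiders_stable]; in the other alternative there are no outsiders. *)
Lemma execution_dynamics : execution V pos -> size_stable V pos 0 ->
  connect (visible V pos 0) ord0 ord_max -> dynamics V pos ord0 ord_max.
Proof.
move=> [h0 hmax hfix hstep] hst hc.
split=> //.
- by move=> t; rewrite !h0.
- by rewrite h0.
- move=> t x x0 xm; exists (l V pos t x), (r V pos t x); split.
    exact: lr_extremes.
  by apply: hstep; rewrite /faulty negb_or x0.
- move=> t x y xy; have [[_ nm nc] _] := hst t (leq0n t).
  rewrite ltNge le_eqVlt; apply/negP => /orP[/eqP e|lt].
    by apply: nm; exists x, y; split=> //; rewrite lt_eqF.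
  by apply: nc; exists x, y.
- move=> t x y xy; have [[ni _ _] _] := hst t (leq0n t).
  by apply/negPn/negP => nxy; apply: ni; exists x, y.
- move=> t x; rewrite h0 => xlt; apply: cvg_tends_to.
  have [_ [/(_ x)|[_ _ _ + _]]] := hst t (leq0n t).
    by rewrite /inside h0 leNgt xlt.
  by move/(_ x); rewrite /left_outsider !h0; apply.
- move=> t x xgt; apply: cvg_tends_to.
  have [_ [/(_ x)|[_ _ _ _]]] := hst t (leq0n t).
    by rewrite /inside hfix andbC leNgt xgt.
  by move/(_ x); rewrite /right_outsider hfix; apply.
Qed.

Lemma primary_chain_exists : dynamics V pos ord0 ord_max ->
  exists C, primary_chain V pos C.
Proof.
move=> dyn0; pose pos' t := pos t.+1.
have dyn : dynamics V pos' ord0 ord_max := dynamics_shift dyn0.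
have tieB t z : z != ord_max -> pos' t z != pos' t ord_max.
  exact: (no_tie dyn0 t).
have tieA t z : z != ord0 -> pos' t z != pos' t ord0.
  by move=> /(no_tie (dynamics_opp dyn0) t); rewrite eqr_opp.
pose l1 := l V pos 1; pose r1 := r V pos 1.
have lP x : sees V pos' 0 x (l1 x) by have [] := l_spec 1 x.
have rP x : sees V pos' 0 x (r1 x) by have [] := r_spec 1 x.
have l_le x y : sees V pos' 0 x y -> pos' 0%N (l1 x) <= pos' 0%N y.
  by have [_] := l_spec 1 x; apply.
have r_ge x y : sees V pos' 0 x y -> pos' 0%N y <= pos' 0%N (r1 x).
  by have [_] := r_spec 1 x; apply.
have [k [a [a0 ak aS]]] := greedy_chain dyn tieA tieB lP rP l_le r_ge.
have eqC := eq_const dyn tieA tieB; have ltC := lt_const dyn tieA tieB.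
pose C := mkseq a k.+1.
have nthC i : (i < k.+1)%N -> nth ord0 C i = a i by move=> ik; rewrite nth_mkseq.
have sizeC : size C = k.+1 by rewrite size_mkseq.
have oheadC : ohead C = Some ord0 by rewrite /C /mkseq /= a0.
clearbody C; exists C; split=> //; first by rewrite -nth_last sizeC nthC.
move=> [//|t] _ _; split.
- split.
    apply: (@sorted_uniq _ <%O); [exact: lt_trans|exact: ltxx|].
    apply/(sortedP 0) => i; rewrite size_map sizeC => ik.
    have ik' := ltnW ik.
    rewrite (nth_map ord0) ?sizeC // (nth_map ord0) ?sizeC //.
    rewrite (nthC _ ik) (nthC _ ik').
    by have [lt _ _] := aS i ik; have := ltC t (a i) (a i.+1); rewrite lt.
  apply/(sortedP ord0) => i; rewrite sizeC => ik.
  rewrite (nthC _ ik) (nthC _ (ltnW ik)); have [_ raS laS] := aS i ik.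
  have ext x := extremes_lr dyn tieA tieB lP rP l_le r_ge t x.
  (* The robots picked by [l] and [r] at time [t.+1] may differ from those picked at time 1, but
     their positions agree. *)
  have [lE _] := extremes_eq erefl (lr_extremes t.+1 (a i.+1)) (ext (a i.+1)).
  have [_ rE] := extremes_eq erefl (lr_extremes t.+1 (a i)) (ext (a i)).
  rewrite /linked lE rE /= -raS eqxx andbT.
  by have := eqC t (l1 (a i.+1)) (a i); rewrite laS eqxx.
- have [[y hy]|no] := pselect (exists y, left_outsider pos t.+1 y).
    by right; exists y.
  left; rewrite /left_anchored -nth0 nthC // a0.
  have [_ h] := l_spec t.+1 ord0; apply/eqP; rewrite eq_le h ?visible_refl //=.
  by rewrite leNgt; apply/negP => lt; apply: no; eexists; exact: lt.
- have [[y hy]|no] := pselect (exists y, right_outsider pos t.+1 y).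
    by right; exists y.
  left; rewrite /right_anchored -nth_last sizeC nthC // ak.
  have [_ h] := r_spec t.+1 ord_max; apply/eqP; rewrite eq_le h ?visible_refl //=.
  by rewrite leNgt andbT; apply/negP => lt; apply: no; eexists; exact: lt.
Qed.

(** Each member's position is that of the rightmost robot seen by its predecessor, which depends
    only on the predecessor's position. *)
Lemma mutual_chain_prefix t C C' :
  mutual_chain V pos t C -> mutual_chain V pos t C' ->
  ohead C = Some ord0 -> ohead C' = Some ord0 ->
  forall i, (i < size C)%N -> (i < size C')%N ->
    pos t (nth ord0 C i) = pos t (nth ord0 C' i).
Proof.
move=> [_ /(sortedP ord0) sC] [_ /(sortedP ord0) sC'] hC hC'.
elim=> [|i IH] iC iC'.
  by case: (C) hC => //= ? ? [->]; case: (C') hC' => //= ? ? [->].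
have /andP[_ /eqP <-] := sC i iC; have /andP[_ /eqP <-] := sC' i iC'.
by apply: pos_r_eq; apply: IH; apply: ltnW.
Qed.

(** If [C] were shorter, [C'] would be at the position of [ord_max] both where [C] ends and at its
    own end, against distinctness of positions. *)
Lemma mutual_chain_size t C C' :
  mutual_chain V pos t C -> mutual_chain V pos t C' ->
  ohead C = Some ord0 -> ohead C' = Some ord0 ->
  last ord0 C = ord_max -> last ord0 C' = ord_max -> (size C' <= size C)%N.
Proof.
move=> mC mC' hC hC' lC lC'; rewrite leqNgt; apply/negP => lt.
have sC0 : (0 < size C)%N by case: (C) hC.
have sC : ((size C).-1 < size C)%N by rewrite prednK.
have := mutual_chain_prefix mC mC' hC hC' sC (ltn_trans sC lt).
rewrite nth_last lC -lC' -nth_last.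
have [u _] := mC'; have i1 := ltn_trans sC lt.
have i2 : ((size C').-1 < size C')%N by rewrite prednK // (leq_trans _ lt).
move/eqP; rewrite -!(nth_map ord0 0 (pos t)) // nth_uniq ?size_map //.
by move/eqP; lia.
Qed.

(** Equal positions suffice for non-faulty robots. Faulty ones must be equal as indices: they occur
    only at the ends of a chain, where both lists agree. *)
Lemma mutual_chain_unique t C C' :
  mutual_chain V pos t C -> mutual_chain V pos t C' ->
  ohead C = Some ord0 -> ohead C' = Some ord0 ->
  last ord0 C = ord_max -> last ord0 C' = ord_max ->
  all2 (same_robot pos t) C' C.
Proof.
move=> mC mC' hC hC' lC lC'.
have sz : size C' = size C.
  by apply/eqP; rewrite eqn_leq !(@mutual_chain_size t).
have faultyP D i : mutual_chain V pos t D -> ohead D = Some ord0 ->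
    last ord0 D = ord_max -> (i < size D)%N -> faulty (nth ord0 D i) ->
    i = 0%N \/ i = (size D).-1.
  move=> [/map_uniq uD _] hD lD iD.
  have D0 : nth ord0 D 0 = ord0 by case: (D) hD => //= ? ? [].
  have sD0 : (0 < size D)%N by apply: leq_ltn_trans iD.
  have sD : ((size D).-1 < size D)%N by rewrite prednK.
  case/orP => /eqP e; [left|right]; apply/eqP; rewrite -(nth_uniq ord0 _ _ uD) //.
    by rewrite e D0.
  by rewrite e nth_last lD.
rewrite all2E sz eqxx /=; apply/(all_nthP (ord0, ord0)) => i.
rewrite size_zip sz minnn => iC; rewrite nth_zip //= /same_robot.
have iC' : (i < size C')%N by rewrite sz.
have endE : i = 0%N \/ i = (size C).-1 -> nth ord0 C' i = nth ord0 C i.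
  case=> ->; last by rewrite nth_last -sz nth_last lC lC'.
  by case: (C) hC => //= ? ? [->]; case: (C') hC' => //= ? ? [->].
case: (boolP (faulty (nth ord0 C' i))) => [/(faultyP _ _ mC' hC' lC' iC')|f'].
  by rewrite sz => /endE ->; rewrite eqxx.
case: (boolP (faulty (nth ord0 C i))) => [/(faultyP _ _ mC hC lC iC)|f].
  by move=> /endE ->; rewrite eqxx.
by rewrite /= (mutual_chain_prefix mC' mC) // eqxx orbT.
Qed.

End Robots.

Theorem theorem12 (R : realType) (n : nat) (V : R)
    (pos : nat -> 'I_n.+1 -> R)
    (V_gt0 : 0 < V)
    (pos_execution : execution V pos)
    (stable0 : size_stable V pos 0%N)
    (x0_xn_connected : connect (visible V pos 0%N) ord0 ord_max) :
  exists C : seq 'I_n.+1,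
    primary_chain V pos C /\
    (forall C' : seq 'I_n.+1, primary_chain V pos C' ->
       forall t : nat, (0 < t)%N -> size_stable V pos t ->
         all2 (same_robot pos t) C' C).
Proof.
have dyn := execution_dynamics V_gt0 pos_execution stable0 x0_xn_connected.
have [C pC] := primary_chain_exists V_gt0 dyn.
exists C; split=> // C' [hC' lC' cC'] t t0 st.
have [hC lC cC] := pC; have [mC _ _] := cC t t0 st; have [mC' _ _] := cC' t t0 st.
exact: mutual_chain_unique mC mC' _ _ _ _.
Qed.
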